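(* Let $k$ be a field and let $k\oplus A$ be a connected quasi-shuffle bialgebra over $k$. Then $Prim(A)=\ker\tilde\Delta$ is stable under $\bullet$, and the map $$\theta:T^+(Prim(A))\longrightarrow A,\qquad a_1\cdots a_n\longmapsto a_1\prec(a_2\prec(\cdots\prec a_n)\cdots)$$ is an isomorphism of quasi-shuffle bialgebras, i.e. a linear bijection compatible with $\prec$, $\bullet$ and the reduced coproducts.
   Context: A quasi-shuffle algebra is a nonunital commutative associative algebra $(A,\bullet)$ with another bilinear product $\prec$ such that $(x\prec y)\prec z=x\prec(y\star z)$ and $(x\bullet y)\prec z=x\bullet(y\prec z)$, where $x\star y:=x\prec y+y\prec x+x\bullet y$. A quasi-shuffle bialgebra is $k\oplus A$, with $A$ a quasi-shuffle algebra and $1$ a unit for $\star$, equipped with a coassociative counital coproduct $\Delta$, $\Delta(1)=1\otimes1$, such that, writing $\tilde\Delta(a)=\Delta(a)-a\otimes1-1\otimes a=:a'\otimes a''\in A\otimes A$ for $a\in A$, for all $x,y\in A$: $\tilde\Delta(x\prec y)=x'\prec y'\otimes x''\star y''+x'\otimes x''\star y+x\prec y'\otimes y''+x'\prec y\otimes x''+x\otimes y$ and $\tilde\Delta(x\bullet y)=x'\bullet y'\otimes x''\star y''+x'\bullet y\otimes x''+x\bullet y'\otimes y''$. It is connected if $A=\bigcup_{n\ge1}\ker\tilde\Delta^{(n)}$, where $\tilde\Delta^{(1)}=\tilde\Delta$ and $\tilde\Delta^{(n)}:A\to A^{\otimes(n+1)}$ is the iterated reduced coproduct. For a nonunital commutative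 algebra $(V,\cdot)$, $T^+(V)=\bigoplus_{n\ge1}V^{\otimes n}$ is the quasi-shuffle algebra with operations defined inductively, for $a,b\in V$ and words $v,w\in T(V)=k\oplus T^+(V)$, by $av\prec bw=a(v\star bw)$, $av\bullet bw=(a\cdot b)(v\star w)$, $av\star bw=a(v\star bw)+b(av\star w)+(a\cdot b)(v\star w)$, $1\star v=v\star 1=v$; its reduced coproduct is $\tilde\Delta(x_1\cdots x_n)=\sum_{i=1}^{n-1}x_1\cdots x_i\otimes x_{i+1}\cdots x_n$. Here $V=Prim(A)$ with the product $\bullet$. *)

(* Defs.v *)
From HB Require Import structures.
From mathcomp Require Import all_boot all_algebra.
From mathcomp Require Import boolp.
From mathcomp Require Import freeg.

Set Implicit Arguments.
Unset Strict Implicit.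
Unset Printing Implicit Defensive.

Import GRing.Theory.
Local Open Scope ring_scope.
Local Open Scope quotient_scope.

(** * Modules given by generators and relations *)

Section Span.
Variables (k : fieldType) (M : lmodType k) (R : M -> Prop).

Inductive span_of : M -> Prop :=
| span_of0 : span_of 0
| span_ofS c r x : R r -> span_of x -> span_of (c *: r + x).

Definition in_span : {pred M} := fun x => `[< span_of x >].

Lemma span_ofP x : reflect (span_of x) (x \in in_span).
Proof. exact: asboolP. Qed.

Lemma span_ofD x y : span_of x -> span_of y -> span_of (x + y).
Proof.
by move=> hx hy; elim: hx => [|c r z hr _ ih]; rewrite ?add0r // -addrA;
  apply: span_ofS.
Qed.

Lemma span_ofZ a x : span_of x -> span_of (a *: x).
Proof.
elim=> [|c r z hr _ ih]; first by rewrite scaler0; constructor.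
by rewrite scalerDr scalerA; apply: span_ofS.
Qed.

Lemma in_span_submod : submod_closed in_span.
Proof.
split=> [|a x y /span_ofP hx /span_ofP hy].
  by apply/span_ofP; constructor.
by apply/span_ofP/span_ofD => //; apply: span_ofZ.
Qed.

HB.instance Definition _ := GRing.isSubmodClosed.Build k M in_span in_span_submod.

End Span.

Section Presentation.
Variables (k : fieldType) (X : choiceType) (R : {freeg X / k} -> Prop).

Definition pres : Type := Quotient.quot (in_span R).
HB.instance Definition _ := GRing.Zmodule.on pres.

Definition pres_pi (f : {freeg X / k}) : pres := \pi_(Quotient.quot (in_span R)) f.
Definition pres_repr (x : pres) : {freeg X / k} :=
  repr (x : Quotient.quot (in_span R)).

Lemma pres_reprK : cancel pres_repr pres_pi.
Proof. exact: reprK. Qed.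

Lemma pres_pi_eq f g : (pres_pi f = pres_pi g) <-> (f - g \in in_span R).
Proof. by rewrite Quotient.idealrBE; split=> [/eqP|/eqP]. Qed.

Lemma pres_piD f g : pres_pi (f + g) = pres_pi f + pres_pi g.
Proof. by rewrite /pres_pi pi_addr. Qed.

Definition pres_scale (c : k) (x : pres) : pres := pres_pi (c *: pres_repr x).

Lemma pres_piZ c f : pres_pi (c *: f) = pres_scale c (pres_pi f).
Proof.
apply/pres_pi_eq; rewrite -scalerBr rpredZ //.
by apply/pres_pi_eq; rewrite pres_reprK.
Qed.

Fact pres_scaleA a b x : pres_scale a (pres_scale b x) = pres_scale (a * b) x.
Proof. by rewrite -[x]pres_reprK -!pres_piZ scalerA. Qed.
Fact pres_scale1 x : pres_scale 1 x = x.
Proof. by rewrite -[x]pres_reprK -pres_piZ scale1r. Qed.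
Fact pres_scaleDr : right_distributive pres_scale +%R.
Proof.
move=> a x y; rewrite -[x]pres_reprK -[y]pres_reprK.
by rewrite -pres_piD -!pres_piZ -pres_piD scalerDr.
Qed.
Fact pres_scaleDl x : {morph pres_scale^~ x : a b / a + b}.
Proof. by move=> a b; rewrite -[x]pres_reprK -!pres_piZ -pres_piD scalerDl. Qed.

HB.instance Definition _ := GRing.Zmodule_isLmodule.Build k pres
  pres_scaleA pres_scale1 pres_scaleDr pres_scaleDl.

Lemma pres_pi_linear : linear pres_pi.
Proof. by move=> c f g; rewrite pres_piD pres_piZ. Qed.
HB.instance Definition _ :=
  GRing.isLinear.Build k {freeg X / k} pres _ pres_pi pres_pi_linear.

Definition pres_gen (x : X) : pres := pres_pi << x >>.

(** Linear extension of [f : X -> M].  It is evaluated on a representative, so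
    it is the map induced by [f] when [f] respects the relations [R]
    ([pres_lift_gen], [pres_lift_linear]). *)
Definition pres_lift (M : lmodType k) (f : X -> M) (x : pres) : M :=
  fglift f (pres_repr x).

Lemma pres_lift_comb (M : lmodType k) (c : k) (f g h : X -> M) :
  (forall x, h x = c *: f x + g x) ->
  forall y, pres_lift h y = c *: pres_lift f y + pres_lift g y.
Proof.
move=> hE y; rewrite /pres_lift; set D := pres_repr y.
have sumE (F : X -> M) : fglift F D = \sum_(z <- repr D) z.1 *: F z.2.
  by unlock fglift.
by rewrite !sumE scaler_sumr -big_split; apply: eq_bigr => z _;
  rewrite hE scalerDr !scalerA mulrC.
Qed.

Section LiftTheory.
Variables (M : lmodType k) (f : X -> M).

Lemma fglift_linear : linear (fglift f).
Proof.
move=> c x y.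
have fD u v : fglift f (u + v) = fglift f u + fglift f v.
  have fB := lift_is_additive f.
  have f0 : fglift f 0 = 0 by rewrite -(subrr 0) fB subrr.
  have fN z : fglift f (- z) = - fglift f z by rewrite -sub0r fB f0 sub0r.
  by rewrite -{1}[v]opprK fB fN opprK.
have f0 : fglift f 0 = 0 by apply: (@addrI _ (fglift f 0)); rewrite -fD !addr0.
have fsum (I : Type) (s : seq I) (F : I -> {freeg X / k}) :
    fglift f (\sum_(i <- s) F i) = \sum_(i <- s) fglift f (F i).
  by apply: (big_morph (fglift f)).
rewrite fD; congr (_ + _).
rewrite -{2}[x]freeg_sumE fsum scaler_sumr -[c *: x]/(fgscale c x) /fgscale fsum.
by apply: eq_bigr => i _; rewrite !liftU scalerA.
Qed.

Hypothesis fR : forall r, R r -> fglift f r = 0.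

Lemma fglift_span r : r \in in_span R -> fglift f r = 0.
Proof.
move/span_ofP; elim=> [|c s x hs _ ih].
  by rewrite -[0](scale0r 0) -[_ *: _]addr0 fglift_linear scale0r add0r
    -[X in fglift f X](scale0r 0) -[LHS]addr0 -{1}(subrr (fglift f 0)) addrA
    -{1}[fglift f (0 *: 0)]scale1r -fglift_linear !scaler0 addr0 subrr.
by rewrite fglift_linear ih fR // scaler0 addr0.
Qed.

Lemma pres_lift_pi g : pres_lift f (pres_pi g) = fglift f g.
Proof.
rewrite /pres_lift; set h := pres_repr _.
have /fglift_span : h - g \in in_span R.
  by apply/pres_pi_eq; rewrite pres_reprK.
rewrite -scaleN1r addrC fglift_linear scaleN1r => /eqP.
by rewrite addrC subr_eq0 => /eqP.
Qed.

Lemma pres_lift_gen x : pres_lift f (pres_gen x) = f x.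
Proof. by rewrite pres_lift_pi liftU scale1r. Qed.

Lemma pres_lift_linear : linear (pres_lift f).
Proof.
move=> c x y; rewrite -[x]pres_reprK -[y]pres_reprK -linearP.
by rewrite !pres_lift_pi fglift_linear.
Qed.

End LiftTheory.
End Presentation.

(** * Tensor products *)

Section Tensor.
Variables (k : fieldType) (U V : lmodType k).

Inductive tens_rel : {freeg (U * V)%type / k} -> Prop :=
| tens_rel_l c u u' v :
    tens_rel (<< (c *: u + u', v) >> - (c *: << (u, v) >> + << (u', v) >>))
| tens_rel_r c u v v' :
    tens_rel (<< (u, c *: v + v') >> - (c *: << (u, v) >> + << (u, v') >>)).

Definition tens : Type := pres tens_rel.
HB.instance Definition _ := GRing.Lmodule.on tens.

Definition tensor (u : U) (v : V) : tens := pres_gen tens_rel (u, v).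

(** [sweedler f t] is $\sum f(t', t'')$ for $t = \sum t' \otimes t''$. *)
Definition sweedler (M : lmodType k) (f : U -> V -> M) (t : tens) : M :=
  pres_lift (R := tens_rel) (fun p => f p.1 p.2) t.

Lemma tensor_bilinear : bilinear_for *:%R *:%R tensor.
Proof.
split=> [v c u u'|u c v v']; rewrite /tensor /pres_gen -linearP;
  apply/pres_pi_eq/span_ofP; rewrite -[X in span_of _ X]addr0
  -[X in span_of _ (X + _)]scale1r; apply: span_ofS; constructor.
Qed.

Section SweedlerTheory.
Variables (M : lmodType k) (f : U -> V -> M).
Hypothesis f_bilin : bilinear_for *:%R *:%R f.

Let f_rel r : tens_rel r -> fglift (fun p => f p.1 p.2) r = 0.
Proof.
case=> [c u u' v|c u v v']; rewrite -scaleN1r addrC !fglift_linear !liftU /=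
  !scale1r scaleN1r.
- by rewrite f_bilin.1 addNr.
- by rewrite f_bilin.2 addNr.
Qed.

Lemma sweedler_tensor u v : sweedler f (tensor u v) = f u v.
Proof. exact: (pres_lift_gen f_rel). Qed.

Lemma sweedler_linear : linear (sweedler f).
Proof. exact: (pres_lift_linear f_rel). Qed.

End SweedlerTheory.
End Tensor.

Notation "u ⊗ v" := (tensor u v) (at level 40, left associativity).

Definition tens_map (k : fieldType) (U V U' V' : lmodType k)
    (f : U -> U') (g : V -> V') : tens U V -> tens U' V' :=
  sweedler (fun u v => f u ⊗ g v).

(** [tens_pow V n] is $V^{\otimes (n+1)}$. *)
Fixpoint tens_pow (k : fieldType) (V : lmodType k) (n : nat) : lmodType k :=
  if n is m.+1 then tens V (tens_pow V m) else V.

(** * Quasi-shuffle algebras *)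

Definition qs_star (k : fieldType) (A : lmodType k) (prec bul : A -> A -> A)
  (x y : A) : A := prec x y + prec y x + bul x y.

Record qsAlgebra (k : fieldType) := QSAlgebra {
  qs_sort :> lmodType k;
  qs_prec : {bilinear qs_sort -> qs_sort -> qs_sort};
  qs_bul : {bilinear qs_sort -> qs_sort -> qs_sort};
  qs_bulA : associative qs_bul;
  qs_bulC : commutative qs_bul;
  qs_precA : forall x y z,
    qs_prec (qs_prec x y) z = qs_prec x (qs_star qs_prec qs_bul y z);
  qs_bul_prec : forall x y z,
    qs_prec (qs_bul x y) z = qs_bul x (qs_prec y z)
}.

Definition star (k : fieldType) (A : qsAlgebra k) : A -> A -> A :=
  qs_star (qs_prec A) (qs_bul A).

Notation "x ≺ y" := (qs_prec _ x y) (at level 45, no associativity).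
Notation "x • y" := (qs_bul _ x y) (at level 45, no associativity).
Notation "x ⋆ y" := (star x y) (at level 45, no associativity).

(** * Quasi-shuffle bialgebras *)

(** $k \oplus A$ *)
Definition unitz (k : fieldType) (A : lmodType k) : lmodType k := (k^o * A)%type.
Definition unitz1 (k : fieldType) (A : lmodType k) : unitz A := (1, 0).
Definition unitz_in (k : fieldType) (A : lmodType k) (a : A) : unitz A := (0, a).
Definition unitz_counit (k : fieldType) (A : lmodType k) (h : unitz A) : k := h.1.

(** [qsb_rcop] is the reduced coproduct; [qsb_rcopE] says that
    $\Delta(a) - a \otimes 1 - 1 \otimes a$ lies in $A \otimes A$, seen inside
    $(k \oplus A)^{\otimes 2}$, and determines [qsb_rcop]. *)
Record qsBialgebra (k : fieldType) := QSBialgebra {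
  qsb_alg :> qsAlgebra k;
  qsb_star : {bilinear unitz qsb_alg -> unitz qsb_alg -> unitz qsb_alg};
  qsb_star_in : forall x y : qsb_alg,
    qsb_star (unitz_in x) (unitz_in y) = unitz_in (x ⋆ y);
  qsb_star1l : left_id (unitz1 qsb_alg) qsb_star;
  qsb_star1r : right_id (unitz1 qsb_alg) qsb_star;
  qsb_cop : {linear unitz qsb_alg -> tens (unitz qsb_alg) (unitz qsb_alg)};
  qsb_coassoc : forall h,
    sweedler (fun x y => sweedler (fun x1 x2 => x1 ⊗ (x2 ⊗ y)) (qsb_cop x))
      (qsb_cop h)
    = sweedler (fun x y => x ⊗ qsb_cop y) (qsb_cop h);
  qsb_counitl : forall h,
    sweedler (fun x y => unitz_counit x *: y) (qsb_cop h) = h;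
  qsb_counitr : forall h,
    sweedler (fun x y => unitz_counit y *: x) (qsb_cop h) = h;
  qsb_cop1 : qsb_cop (unitz1 qsb_alg) = unitz1 qsb_alg ⊗ unitz1 qsb_alg;
  qsb_rcop : {linear qsb_alg -> tens qsb_alg qsb_alg};
  qsb_rcopE : forall a : qsb_alg,
    tens_map (@unitz_in _ _) (@unitz_in _ _) (qsb_rcop a)
    = qsb_cop (unitz_in a) - unitz_in a ⊗ unitz1 qsb_alg
      - unitz1 qsb_alg ⊗ unitz_in a;
  qsb_rcop_prec : forall x y : qsb_alg,
    qsb_rcop (x ≺ y)
    = sweedler (fun x1 x2 =>
        sweedler (fun y1 y2 => (x1 ≺ y1) ⊗ (x2 ⋆ y2)) (qsb_rcop y)) (qsb_rcop x)
      + sweedler (fun x1 x2 => x1 ⊗ (x2 ⋆ y)) (qsb_rcop x)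
      + sweedler (fun y1 y2 => (x ≺ y1) ⊗ y2) (qsb_rcop y)
      + sweedler (fun x1 x2 => (x1 ≺ y) ⊗ x2) (qsb_rcop x)
      + x ⊗ y;
  qsb_rcop_bul : forall x y : qsb_alg,
    qsb_rcop (x • y)
    = sweedler (fun x1 x2 =>
        sweedler (fun y1 y2 => (x1 • y1) ⊗ (x2 ⋆ y2)) (qsb_rcop y)) (qsb_rcop x)
      + sweedler (fun x1 x2 => (x1 • y) ⊗ x2) (qsb_rcop x)
      + sweedler (fun y1 y2 => (x • y1) ⊗ y2) (qsb_rcop y)
}.

Section Connected.
Variables (k : fieldType) (A : qsBialgebra k).

(** $\tilde\Delta^{(n)} = (\mathrm{id} \otimes \tilde\Delta^{(n-1)}) \circ
    \tilde\Delta$, with $\tilde\Delta^{(0)} = \mathrm{id}$. *)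
Fixpoint iter_rcop (n : nat) : A -> tens_pow A n :=
  if n is m.+1 return A -> tens_pow A n
  then fun a => tens_map id (iter_rcop m) (qsb_rcop A a)
  else id.

Definition qs_connected : Prop :=
  forall a : A, exists n, (1 <= n)%N /\ iter_rcop n a = 0.

End Connected.

Section Prim.
Variables (k : fieldType) (A : qsBialgebra k).

Definition prim : {pred A} := fun a => qsb_rcop A a == 0.

Lemma prim_submod : submod_closed prim.
Proof.
split=> [|c x y]; first by rewrite unfold_in linear0.
by rewrite !unfold_in linearP => /eqP -> /eqP ->; rewrite scaler0 addr0.
Qed.
HB.instance Definition _ := GRing.isSubmodClosed.Build k A prim prim_submod.

Definition Prim : Type := {a : A | a \in prim}.
HB.instance Definition _ := SubChoice.on Prim.
HB.instance Definition _ := [SubChoice_isSubLmodule of Prim by <:].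

Definition prim_stable : Prop :=
  forall x y : A, x \in prim -> y \in prim -> x • y \in prim.

Definition prim_bul (st : prim_stable) (x y : Prim) : Prim :=
  Sub (val x • val y) (st _ _ (valP x) (valP y)).

End Prim.

(** * The quasi-shuffle algebra of words *)

Section Words.
Variables (k : fieldType) (V : lmodType k).

(** The pair [(a, s)] stands for the nonempty word [a :: s]. *)
Definition word_at (s1 : seq V) (a : V) (s2 : seq V) : V * seq V :=
  if s1 is b :: s then (b, s ++ a :: s2) else (a, s2).

Inductive tplus_rel : {freeg (V * seq V)%type / k} -> Prop :=
| Tplus_rel s1 s2 c a b :
    tplus_rel (<< word_at s1 (c *: a + b) s2 >>
      - (c *: << word_at s1 a s2 >> + << word_at s1 b s2 >>)).

(** $T^+(V) = \bigoplus_{n \geq 1} V^{\otimes n}$, as the free module on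
    nonempty words modulo linearity in each letter. *)
Definition Tplus : Type := pres tplus_rel.
HB.instance Definition _ := GRing.Lmodule.on Tplus.

(** The class of a nonempty word (the empty word is not in $T^+(V)$; it is
    sent to [0]). *)
Definition word (s : seq V) : Tplus :=
  if s is a :: s' then pres_gen tplus_rel (a, s') else 0.

Definition word_lift (M : lmodType k) (f : seq V -> M) (x : Tplus) : M :=
  pres_lift (R := tplus_rel) (fun v => f (v.1 :: v.2)) x.

Definition multilinear (M : lmodType k) (f : seq V -> M) : Prop :=
  forall s1 s2 c a b,
    f (s1 ++ (c *: a + b) :: s2) = c *: f (s1 ++ a :: s2) + f (s1 ++ b :: s2).

Lemma word_multilinear : multilinear word.
Proof.
move=> s1 s2 c a b.
have wordE e : word (s1 ++ e :: s2) = pres_pi tplus_rel << word_at s1 e s2 >>.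
  by case: s1.
rewrite !wordE -linearP; apply/pres_pi_eq/span_ofP.
by rewrite -[X in span_of _ X]addr0 -[X in span_of _ (X + _)]scale1r;
  apply: span_ofS; constructor.
Qed.

Section WordLiftTheory.
Variables (M : lmodType k) (f : seq V -> M).
Hypothesis f_mlin : multilinear f.

Let f_rel r : tplus_rel r -> fglift (fun v => f (v.1 :: v.2)) r = 0.
Proof.
case=> s1 s2 c a b; rewrite -scaleN1r addrC !fglift_linear !liftU !scale1r.
have E e : f ((word_at s1 e s2).1 :: (word_at s1 e s2).2) = f (s1 ++ e :: s2).
  by case: s1.
by rewrite !E f_mlin scaleN1r addNr.
Qed.

Lemma word_lift_word a s : word_lift f (word (a :: s)) = f (a :: s).
Proof. exact: (pres_lift_gen f_rel). Qed.

Lemma word_lift_linear : linear (word_lift f).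
Proof. exact: (pres_lift_linear f_rel). Qed.

End WordLiftTheory.

Variable m : V -> V -> V.

(** On words, the products of $T^+(V)$ are sums of words with coefficient 1;
    the functions below list these words, with multiplicity. *)
Fixpoint star_words (v : seq V) : seq V -> seq (seq V) :=
  if v is a :: v' then
    fix star_v w := if w is b :: w' then
        [seq a :: u | u <- star_words v' w]
        ++ [seq b :: u | u <- star_v w']
        ++ [seq m a b :: u | u <- star_words v' w']
      else [:: v]
  else fun w => [:: w].

Definition prec_words (v w : seq V) : seq (seq V) :=
  if (v, w) is (a :: v', b :: w') then [seq a :: u | u <- star_words v' w]
  else [::].

Definition bul_words (v w : seq V) : seq (seq V) :=
  if (v, w) is (a :: v', b :: w') then [seq m a b :: u | u <- star_words v' w']
  else [::].

Definition bilift (p : seq V -> seq V -> seq (seq V)) (x y : Tplus) : Tplus :=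
  word_lift (fun v => word_lift (fun w => \sum_(u <- p v w) word u) y) x.

Definition tplus_prec : Tplus -> Tplus -> Tplus := bilift prec_words.
Definition tplus_bul : Tplus -> Tplus -> Tplus := bilift bul_words.

Section ProductTheory.
Hypothesis m_bilin : bilinear_for *:%R *:%R m.
Variables (M : lmodType k).

Let sum_lin (I : Type) (r : seq I) (f g h : I -> M) c :
  (forall i, h i = c *: f i + g i) ->
  \sum_(i <- r) h i = c *: \sum_(i <- r) f i + \sum_(i <- r) g i.
Proof. by move=> hE; rewrite scaler_sumr -big_split; apply: eq_bigr. Qed.

Let comb3 c (x x' y y' z z' : M) :
  (c *: x + x') + ((c *: y + y') + (c *: z + z'))
  = c *: (x + (y + z)) + (x' + (y' + z')).
Proof. by rewrite !scalerDr (addrACA (c *: y)) (addrACA (c *: x)). Qed.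

Let multilinear_cons (F : seq V -> M) a :
  multilinear F -> multilinear (fun u => F (a :: u)).
Proof. by move=> FP s1; apply: (FP (a :: s1)). Qed.

Let sum_star_cons (F : seq V -> M) a v b w :
  \sum_(u <- star_words (a :: v) (b :: w)) F u
  = \sum_(u <- star_words v (b :: w)) F (a :: u)
    + (\sum_(u <- star_words (a :: v) w) F (b :: u)
       + \sum_(u <- star_words v w) F (m a b :: u)).
Proof. by rewrite /= !(big_cat, big_map). Qed.

Lemma star_words_mlinl (F : seq V -> M) w : multilinear F ->
  multilinear (fun v => \sum_(u <- star_words v w) F u).
Proof.
move=> FP s1 s2 c a b; elim: s1 w F FP => [|x s1 ih] w.
  elim: w => [|d w ihw] F FP; first by rewrite /= !big_seq1 (FP [::]).
  rewrite !cat0s !sum_star_cons -comb3; congr (_ + (_ + _)).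
  - exact: sum_lin _ (fun u => FP [::] u c a b).
  - exact: ihw _ (multilinear_cons d FP).
  - by apply: sum_lin => u; rewrite m_bilin.1 (FP [::]).
elim: w => [|d w ihw] F FP; first by rewrite /= !big_seq1 (FP (x :: s1)).
rewrite !cat_cons !sum_star_cons -comb3; congr (_ + (_ + _)).
- exact: ih _ _ (multilinear_cons x FP).
- exact: ihw _ (multilinear_cons d FP).
- exact: ih _ _ (multilinear_cons (m x d) FP).
Qed.

Lemma star_words_mlinr (F : seq V -> M) v : multilinear F ->
  multilinear (fun w => \sum_(u <- star_words v w) F u).
Proof.
move=> FP s1 s2 c a b; elim: v s1 F FP => [|x v ih] s1 F FP.
  by rewrite /= !big_seq1 FP.
elim: s1 F FP => [|d s1 ihs] F FP.
  rewrite !cat0s !sum_star_cons -comb3; congr (_ + (_ + _)).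
  - exact: ih [::] _ (multilinear_cons x FP).
  - exact: sum_lin _ (fun u => FP [::] u c a b).
  - by apply: sum_lin => u; rewrite m_bilin.2 (FP [::]).
rewrite !cat_cons !sum_star_cons -comb3; congr (_ + (_ + _)).
- exact: ih (d :: s1) _ (multilinear_cons x FP).
- exact: ihs _ (multilinear_cons d FP).
- exact: ih _ _ (multilinear_cons (m x d) FP).
Qed.

Lemma prec_words_mlinl (F : seq V -> M) w : multilinear F ->
  multilinear (fun v => \sum_(u <- prec_words v w) F u).
Proof.
case: w => [|d w] FP; first by case=> [|x s1] *; rewrite !big_nil scaler0 addr0.
case=> [|x s1] s2 c a b; rewrite !big_map.
  exact: sum_lin _ (fun u => FP [::] u c a b).
exact: star_words_mlinl _ (multilinear_cons x FP) _ _ _ _ _.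
Qed.

Lemma prec_words_mlinr (F : seq V -> M) v : multilinear F ->
  multilinear (fun w => \sum_(u <- prec_words v w) F u).
Proof.
case: v => [|x v] FP s1 s2 c a b; first by rewrite !big_nil scaler0 addr0.
have E w1 e w2 : prec_words (x :: v) (w1 ++ e :: w2)
  = [seq x :: u | u <- star_words v (w1 ++ e :: w2)] by case: w1.
by rewrite !E !big_map (star_words_mlinr _ (multilinear_cons x FP)).
Qed.

Lemma bul_words_mlinl (F : seq V -> M) w : multilinear F ->
  multilinear (fun v => \sum_(u <- bul_words v w) F u).
Proof.
case: w => [|d w] FP; first by case=> [|x s1] *; rewrite !big_nil scaler0 addr0.
case=> [|x s1] s2 c a b; rewrite !big_map.
  by apply: sum_lin => u; rewrite m_bilin.1 (FP [::]).
exact: star_words_mlinl _ (multilinear_cons (m x d) FP) _ _ _ _ _.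
Qed.

Lemma bul_words_mlinr (F : seq V -> M) v : multilinear F ->
  multilinear (fun w => \sum_(u <- bul_words v w) F u).
Proof.
case: v => [|x v] FP; first by move=> *; rewrite !big_nil scaler0 addr0.
case=> [|d s1] s2 c a b; rewrite !big_map.
  by apply: sum_lin => u; rewrite m_bilin.2 (FP [::]).
exact: star_words_mlinr _ (multilinear_cons (m x d) FP) _ _ _ _ _.
Qed.

End ProductTheory.

Section ProductWords.
Hypothesis m_bilin : bilinear_for *:%R *:%R m.

Let bilift_word p :
  (forall w, multilinear (fun v => \sum_(u <- p v w) word u)) ->
  (forall v, multilinear (fun w => \sum_(u <- p v w) word u)) ->
  forall a v b w, bilift p (word (a :: v)) (word (b :: w))
    = \sum_(u <- p (a :: v) (b :: w)) word u.
Proof.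
move=> pl pr a v b w; rewrite /bilift word_lift_word ?word_lift_word //.
by move=> s1 s2 c x y; apply: pres_lift_comb => z; apply: pl.
Qed.

Lemma tplus_prec_word a v b w :
  tplus_prec (word (a :: v)) (word (b :: w))
  = \sum_(u <- star_words v (b :: w)) word (a :: u).
Proof.
rewrite /tplus_prec bilift_word ?big_map // => s.
  by apply: prec_words_mlinl => //; apply: word_multilinear.
by apply: prec_words_mlinr => //; apply: word_multilinear.
Qed.

Lemma tplus_bul_word a v b w :
  tplus_bul (word (a :: v)) (word (b :: w))
  = \sum_(u <- star_words v w) word (m a b :: u).
Proof.
rewrite /tplus_bul bilift_word ?big_map // => s.
  by apply: bul_words_mlinl => //; apply: word_multilinear.
by apply: bul_words_mlinr => //; apply: word_multilinear.
Qed.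

End ProductWords.

Definition tplus_rcop : Tplus -> tens Tplus Tplus :=
  word_lift (fun s => \sum_(1 <= i < size s) word (take i s) ⊗ word (drop i s)).

Lemma tplus_rcop_word a s : tplus_rcop (word (a :: s))
  = \sum_(1 <= i < (size s).+1)
      word (take i (a :: s)) ⊗ word (drop i (a :: s)).
Proof.
apply: word_lift_word => s1 s2 c x y; have [tl tr] := @tensor_bilinear k Tplus Tplus.
rewrite !size_cat /= scaler_sumr -big_split; apply: eq_bigr => i _ /=.
rewrite !take_cat !drop_cat; case: ltnP => [_|le_s1i].
  by rewrite word_multilinear tr.
case: (i - size s1)%N => [|j]; last by rewrite /= word_multilinear tl.
rewrite !drop0 !take0.
have -> := word_multilinear [::] s2 c x y : word (c *: x + y :: s2) = _.
by rewrite tr.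
Qed.

End Words.

Section Theta.
Variables (k : fieldType) (A : qsBialgebra k).

Fixpoint iter_prec (a : A) (s : seq A) : A :=
  if s is b :: s' then a ≺ iter_prec b s' else a.

End Theta.

(* Main.v *)
(** Because [A] is connected, an equation [g a = f a + Psi a' (g a'')] has
    exactly one solution [g], and by coassociativity [g a = Psi (g a') a''] has
    only the zero solution.  Solving such equations gives a linear map [p] with
    [p a = a - p a' ≺ a''], and uniqueness shows that [p a] is primitive.  The
    map [phi a = p a + p a' · phi a''], where [·] puts a letter in front of a
    word, is then the inverse of [theta]: [theta (phi a) = a] by uniqueness, and
    [phi (theta w) = w] because [p (b ≺ a) = 0] for [b] primitive, again by
    uniqueness. *)

Require Import Defs.
From HB Require Import structures.
From mathcomp Require Import all_boot all_algebra.
From mathcomp Require Import boolp.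
From mathcomp Require Import freeg.

Set Implicit Arguments.
Unset Strict Implicit.
Unset Printing Implicit Defensive.

Import GRing.Theory.
Local Open Scope ring_scope.

Local Notation bilinear f := (bilinear_for *:%R *:%R f).
Local Notation "\sw_ ( x , y <- t ) F" := (sweedler (fun x y => F) t)
  (at level 41, x name, y name, t at level 41, F at level 41).

(** * Linear maps on modules given by presentations *)

Section LinearProp.
Variables (k : fieldType) (U V : lmodType k) (f : U -> V).
Hypothesis f_lin : linear f.

Lemma lin0 : f 0 = 0.
Proof.
have := f_lin (-1) 0 0; rewrite !scaleN1r oppr0 addr0 => {1}->.
by rewrite addNr.
Qed.

Lemma linD x y : f (x + y) = f x + f y.
Proof. by rewrite -{1}[x]scale1r f_lin scale1r. Qed.

Lemma linZ c x : f (c *: x) = c *: f x.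
Proof. by rewrite -{1}[c *: x]addr0 f_lin lin0 addr0. Qed.

Lemma linN x : f (- x) = - f x.
Proof. by rewrite -scaleN1r linZ scaleN1r. Qed.

Lemma lin_sum I (r : seq I) (P : pred I) F :
  f (\sum_(i <- r | P i) F i) = \sum_(i <- r | P i) f (F i).
Proof. exact: (big_morph f linD lin0). Qed.

End LinearProp.

Lemma lin_fD (k : fieldType) (U V : lmodType k) (f g : U -> V) :
  linear f -> linear g -> linear (fun x => f x + g x).
Proof.
by move=> f_lin g_lin c x y; rewrite f_lin g_lin addrACA -scalerDr.
Qed.

Lemma lin_fN (k : fieldType) (U V : lmodType k) (f : U -> V) :
  linear f -> linear (fun x => - f x).
Proof. by move=> f_lin c x y; rewrite f_lin opprD scalerN. Qed.

Lemma lin_fB (k : fieldType) (U V : lmodType k) (f g : U -> V) :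
  linear f -> linear g -> linear (fun x => f x - g x).
Proof. by move=> f_lin g_lin; apply: lin_fD => //; apply: lin_fN. Qed.

Section PresTheory.
Variables (k : fieldType) (X : choiceType) (R : {freeg X / k} -> Prop).
Implicit Type x : pres R.

Lemma pres_liftE (M : lmodType k) (f : X -> M) x :
  pres_lift f x
  = \sum_(z <- fgenum (pres_repr x)) z.1 *: f z.2.
Proof. by rewrite /pres_lift; unlock fglift. Qed.

Lemma pres_lift_ext (M : lmodType k) (f g : X -> M) x :
  f =1 g -> pres_lift f x = pres_lift g x.
Proof. by move=> fg; rewrite !pres_liftE; apply: eq_bigr => z _; rewrite fg. Qed.

Lemma lin_pres_lift (M N : lmodType k) (L : M -> N) (f : X -> M) x :
  linear L -> L (pres_lift f x) = pres_lift (L \o f) x.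
Proof.
move=> L_lin; rewrite !pres_liftE (lin_sum L_lin).
by apply: eq_bigr => z _; rewrite (linZ L_lin).
Qed.

(** Combined with [lin_pres_lift], this writes every linear map on [pres R] as the lift of its
    values on generators, whence [pres_lin_ext]. *)
Lemma pres_lift_genK x : pres_lift (@pres_gen _ _ R) x = x.
Proof.
rewrite /pres_lift -[RHS]pres_reprK -[X in fglift _ X]freeg_sumE.
rewrite -[X in _ = pres_pi _ X]freeg_sumE linear_sum.
rewrite (lin_sum (fglift_linear _)); apply: eq_bigr => z _.
rewrite liftU /pres_gen -linearZ; congr (pres_pi _ _).
by apply/eqP/freeg_eqP => y; rewrite coeffZ !coeffU mul1r.
Qed.

Lemma pres_lin_ext (M : lmodType k) (f g : pres R -> M) :
  linear f -> linear g -> (forall z, f (pres_gen R z) = g (pres_gen R z)) ->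
  f =1 g.
Proof.
move=> f_lin g_lin fg x; rewrite -[x]pres_lift_genK !lin_pres_lift //.
exact: pres_lift_ext.
Qed.

End PresTheory.

(** * Sweedler sums and maps between tensor products *)

Section SweedlerCalculus.
Variables (k : fieldType) (U V : lmodType k).
Implicit Type t : tens U V.

Lemma sw_ext (M : lmodType k) (f g : U -> V -> M) t :
  (forall u v, f u v = g u v) -> sweedler f t = sweedler g t.
Proof. by move=> fg; apply: pres_lift_ext => -[u v]; apply: fg. Qed.

Lemma lin_sw (M N : lmodType k) (L : M -> N) (f : U -> V -> M) t :
  linear L -> L (sweedler f t) = sweedler (fun u v => L (f u v)) t.
Proof. by move=> L_lin; rewrite /sweedler lin_pres_lift. Qed.

Lemma sw_tensorK t : sweedler (@tensor k U V) t = t.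
Proof. by rewrite -[RHS]pres_lift_genK; apply: pres_lift_ext => -[u v]. Qed.

Lemma sw_comb (M : lmodType k) c (f g : U -> V -> M) t :
  sweedler (fun u v => c *: f u v + g u v) t
  = c *: sweedler f t + sweedler g t.
Proof. exact: pres_lift_comb. Qed.

Lemma swD (M : lmodType k) (f g : U -> V -> M) t :
  sweedler (fun u v => f u v + g u v) t = sweedler f t + sweedler g t.
Proof.
rewrite -[sweedler f t]scale1r -sw_comb; apply: sw_ext => u v.
by rewrite scale1r.
Qed.

Lemma sw0 (M : lmodType k) t : sweedler (fun _ _ => 0 : M) t = 0.
Proof.
by apply: (@addrI _ (sweedler (fun _ _ => 0) t)); rewrite -swD !addr0.
Qed.

Lemma swN (M : lmodType k) (f : U -> V -> M) t :
  sweedler (fun u v => - f u v) t = - sweedler f t.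
Proof.
apply: (@addrI _ (sweedler f t)); rewrite -swD subrr -[RHS](sw0 _ t).
by apply: sw_ext => u v; rewrite subrr.
Qed.

Lemma swB (M : lmodType k) (f g : U -> V -> M) t :
  sweedler (fun u v => f u v - g u v) t = sweedler f t - sweedler g t.
Proof. by rewrite swD swN. Qed.

Lemma sw_of0 (M : lmodType k) (f : U -> V -> M) :
  bilinear f -> sweedler f 0 = 0.
Proof. by move=> f_bil; apply: lin0; apply: sweedler_linear. Qed.

Lemma sw_ofD (M : lmodType k) (f : U -> V -> M) s t :
  bilinear f -> sweedler f (s + t) = sweedler f s + sweedler f t.
Proof. by move=> f_bil; apply: linD; apply: sweedler_linear. Qed.

Lemma tensorPl c u u' (v : V) : (c *: u + u' : U) ⊗ v = c *: (u ⊗ v) + u' ⊗ v.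
Proof. by rewrite (tensor_bilinear U V).1. Qed.

Lemma tensorPr c (u : U) v v' : u ⊗ (c *: v + v' : V) = c *: (u ⊗ v) + u ⊗ v'.
Proof. by rewrite (tensor_bilinear U V).2. Qed.

(* [sweedler f t] is a sum over a finite set of pairs that depends only on [t],
   so pointwise eventual properties hold uniformly over it. *)
Lemma sw_eventually (P : nat -> U -> V -> Prop) t :
  (forall u v, exists N, forall n, (N <= n)%N -> P n u v) ->
  exists N, forall n, (N <= n)%N -> forall (M : lmodType k) (f g : U -> V -> M),
    (forall u v, P n u v -> f u v = g u v) -> sweedler f t = sweedler g t.
Proof.
move=> P_ev; rewrite /sweedler.
suff [N NP] : exists N, forall n, (N <= n)%N ->
    forall z, z \in fgenum (pres_repr t) -> P n z.2.1 z.2.2.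
  exists N => n Nn M f g fg; rewrite !pres_liftE !big_seq.
  by apply: eq_bigr => z zt; rewrite fg //; apply: NP Nn _ zt.
elim: (fgenum _) => [|z s [N NP]]; first by exists 0%N.
have [N' NP'] := P_ev z.2.1 z.2.2; exists (maxn N N') => n.
rewrite geq_max => /andP[Nn N'n] y; rewrite inE => /orP[/eqP->|].
  exact: NP'.
exact: NP.
Qed.

End SweedlerCalculus.

Section TensMap.
Variables (k : fieldType) (U V U' V' : lmodType k) (f : U -> U') (g : V -> V').
Hypotheses (f_lin : linear f) (g_lin : linear g).

Lemma tens_map_bilinear : bilinear (fun u v => f u ⊗ g v).
Proof.
by split=> [v c u u'|u c v v']; rewrite ?f_lin ?g_lin ?tensorPl ?tensorPr.
Qed.

Lemma tens_map_tensor u v : tens_map f g (u ⊗ v) = f u ⊗ g v.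
Proof. by rewrite /tens_map (sweedler_tensor tens_map_bilinear). Qed.

Lemma tens_map_linear : linear (tens_map f g).
Proof. exact: sweedler_linear tens_map_bilinear. Qed.

Lemma sw_tens_map (M : lmodType k) (h : U' -> V' -> M) t :
  bilinear h ->
  sweedler h (tens_map f g t) = sweedler (fun u v => h (f u) (g v)) t.
Proof.
move=> h_bil; rewrite /tens_map lin_sw; last exact: sweedler_linear.
by apply: sw_ext => u v; rewrite sweedler_tensor.
Qed.

End TensMap.

(** * Linear maps on words, and putting a letter in front *)

Section WordCalculus.
Variables (k : fieldType) (V M : lmodType k).
Implicit Type x : Tplus V.

Lemma word_lift_ext (f g : seq V -> M) x :
  (forall a s, f (a :: s) = g (a :: s)) -> word_lift f x = word_lift g x.
Proof. by move=> fg; apply: pres_lift_ext => -[a s]; apply: fg. Qed.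

Lemma word_lin_ext (f g : Tplus V -> M) :
  linear f -> linear g -> (forall a s, f (word (a :: s)) = g (word (a :: s))) ->
  f =1 g.
Proof.
by move=> f_lin g_lin fg; apply: pres_lin_ext => // -[a s]; apply: fg.
Qed.

Lemma word_lift_comb c (f g : seq V -> M) x :
  word_lift (fun s => c *: f s + g s) x = c *: word_lift f x + word_lift g x.
Proof. exact: pres_lift_comb. Qed.

End WordCalculus.

Section WordCons.
Variables (k : fieldType) (V : lmodType k).

Definition wcons (a : V) (x : Tplus V) : Tplus V :=
  word_lift (fun s => word (a :: s)) x.

Let word_cons_mlin (a : V) : multilinear (fun s => word (a :: s)).
Proof. by move=> s1; apply: (word_multilinear (a :: s1)). Qed.

Lemma wcons_word a b s : wcons a (word (b :: s)) = word (a :: b :: s).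
Proof. exact: (word_lift_word (word_cons_mlin a)). Qed.

Lemma wcons_bilinear : bilinear wcons.
Proof.
split=> [x c a b|a]; last exact: word_lift_linear (word_cons_mlin a).
rewrite -word_lift_comb; apply: word_lift_ext => d s.
exact: (word_multilinear [::]).
Qed.

End WordCons.

(** * Quasi-shuffle identities and reduced coassociativity *)

Section QuasiShuffleAlgebra.
Variables (k : fieldType) (A : qsAlgebra k).
Implicit Types x y z : A.

Lemma precPl c x x' y : ((c *: x + x') ≺ y) = c *: (x ≺ y) + (x' ≺ y).
Proof. exact: (@linearPl _ _ _ _ _ _ (qs_prec A) y c x x'). Qed.

Lemma precPr c x y y' : (x ≺ (c *: y + y')) = c *: (x ≺ y) + (x ≺ y').
Proof. exact: (@linearPr _ _ _ _ _ _ (qs_prec A) x c y y'). Qed.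

Lemma bulPr c x y y' : (x • (c *: y + y')) = c *: (x • y) + (x • y').
Proof. exact: (@linearPr _ _ _ _ _ _ (qs_bul A) x c y y'). Qed.

Lemma bulPl c x x' y : ((c *: x + x') • y) = c *: (x • y) + (x' • y).
Proof. exact: (@linearPl _ _ _ _ _ _ (qs_bul A) y c x x'). Qed.

Lemma prec_bilinear : bilinear (qs_prec A).
Proof. by split=> [y c x x'|x c y y']; rewrite ?precPl ?precPr. Qed.

Lemma bul_bilinear : bilinear (qs_bul A).
Proof. by split=> [y c x x'|x c y y']; rewrite ?bulPl ?bulPr. Qed.

Lemma starE x y : (x ⋆ y) = (x ≺ y) + (y ≺ x) + (x • y).
Proof. by []. Qed.

Lemma starC x y : (x ⋆ y) = (y ⋆ x).
Proof. by rewrite !starE (addrC (x ≺ y)) qs_bulC. Qed.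

Lemma starPl c x x' y : ((c *: x + x') ⋆ y) = c *: (x ⋆ y) + (x' ⋆ y).
Proof.
rewrite !starE precPl precPr bulPl !scalerDr.
by rewrite (addrACA (c *: _)) [LHS]addrACA.
Qed.

Lemma starPr c x y y' : (x ⋆ (c *: y + y')) = c *: (x ⋆ y) + (x ⋆ y').
Proof. by rewrite starC starPl !(starC x). Qed.

Lemma star_bilinear : bilinear (@star k A).
Proof. by split=> [y c x x'|x c y y']; rewrite ?starPl ?starPr. Qed.

Lemma precDl x x' y : ((x + x') ≺ y) = (x ≺ y) + (x' ≺ y).
Proof. exact: linD (prec_bilinear.1 y) x x'. Qed.

Lemma bulDr x y y' : (x • (y + y')) = (x • y) + (x • y').
Proof. exact: linD (bul_bilinear.2 x) y y'. Qed.

Lemma bul_precCA x y z : (x • (y ≺ z)) = (y • (x ≺ z)).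
Proof. by rewrite -!qs_bul_prec [(x • y)]qs_bulC. Qed.

(* By [bul_precCA], this expression is invariant under cyclic permutations of
   [x], [y] and [z]. *)
Let star_starE x y z : ((x ⋆ y) ⋆ z)
  = ((x ≺ (y ⋆ z)) + (y ≺ (z ⋆ x)) + (z ≺ (x ⋆ y)))
    + ((x • (y ≺ z)) + (y • (z ≺ x)) + (z • (x ≺ y))) + (x • (y • z)).
Proof.
rewrite [LHS]starE [in X in X + _ + _]starE !precDl !qs_precA qs_bul_prec.
rewrite -/(star y z) -/(star x z) (starC z x).
rewrite [((x ⋆ y) • z)]qs_bulC [in X in _ + X]starE !bulDr.
rewrite (bul_precCA z y x) [(z • (x • y))]qs_bulC -qs_bulA.
set a := (x ≺ _); set b := (y ≺ _); set c := (z ≺ _).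
set d := (x • (y ≺ z)); set e := (z • (x ≺ y)); set f := (y • _).
rewrite addrA -[a + b + d + c]addrA [d + c]addrC !addrA; congr (_ + _).
by rewrite -!addrA; do 4!congr (_ + _); rewrite addrC.
Qed.

(** By commutativity the left side is [(y ⋆ z) ⋆ x], whose expansion by [star_starE] is a cyclic
    permutation of that of the right side. *)
Lemma starA x y z : (x ⋆ (y ⋆ z)) = ((x ⋆ y) ⋆ z).
Proof.
rewrite (starC x) !star_starE; congr (_ + _ + _).
- by rewrite addrC addrA.
- by rewrite addrC addrA.
by rewrite qs_bulA qs_bulC.
Qed.

(** The counterpart in [A] of the rule av • bw = (a·b)(v ⋆ w) on words. *)
Lemma bul_prec_prec x y z t :
  ((x ≺ z) • (y ≺ t)) = ((x • y) ≺ (z ⋆ t)).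
Proof.
by rewrite qs_bulC -qs_bul_prec [(_ • x)]qs_bulC qs_bul_prec qs_precA
  -qs_bul_prec -/(star t z) starC.
Qed.

End QuasiShuffleAlgebra.

Section ReducedCoproduct.
Variables (k : fieldType) (A : qsBialgebra k).
Local Notation Δ := (qsb_rcop A).
Implicit Types (x y z a : A) (M : lmodType k).

Lemma rcop_lin : linear Δ.
Proof. by move=> c x y; rewrite linearP. Qed.

Lemma sw_rcopP M (f : A -> A -> M) : bilinear f ->
  linear (fun a => \sw_(x, y <- Δ a) f x y).
Proof.
by move=> f_bil c a b; rewrite rcop_lin; apply: (sweedler_linear f_bil).
Qed.

Let pr (h : unitz A) : A := h.2.

Let pr_lin : linear pr. Proof. by []. Qed.

Let unitz_in_lin : linear (@unitz_in k A).
Proof. by move=> c x y; congr pair; rewrite /= scaler0 addr0. Qed.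

(** Projecting both factors to [A] kills every term of the coproduct with a factor 1, so only the
    reduced part survives. *)
Let pr_cop h : tens_map pr pr (qsb_cop A h) = Δ (pr h).
Proof.
have -> : h = h.1 *: unitz1 A + unitz_in h.2.
  by case: h => c a; congr pair; rewrite /= ?scaler0 ?add0r // addr0 [RHS]mulr1.
have pp_lin := tens_map_linear pr_lin pr_lin.
rewrite linearP pp_lin pr_lin rcop_lin; congr (_ *: _ + _).
  rewrite qsb_cop1 tens_map_tensor // (lin0 rcop_lin).
  exact: lin0 ((tensor_bilinear A A).1 _).
rewrite -[Δ _]sw_tensorK.
have -> : qsb_cop A (unitz_in h.2)
  = tens_map (@unitz_in _ _) (@unitz_in _ _) (Δ h.2)
  + unitz1 A ⊗ unitz_in h.2 + unitz_in h.2 ⊗ unitz1 A.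
  by rewrite qsb_rcopE !subrK.
rewrite !(linD pp_lin) !tens_map_tensor // [in X in _ + X]/pr /=.
rewrite (lin0 ((tensor_bilinear A A).2 _)) (lin0 ((tensor_bilinear A A).1 _)).
rewrite !addr0 [tens_map pr pr _]sw_tens_map //.
exact: tens_map_bilinear.
Qed.

(** Apply [pr] to the three factors of [qsb_coassoc]; [pr_cop], used twice on each side, turns the
    coproducts into reduced ones. *)
Let rcop_coassoc_tens a :
  \sw_(x, y <- Δ a) \sw_(x1, x2 <- Δ x) x1 ⊗ (x2 ⊗ y)
  = \sw_(x, y <- Δ a) x ⊗ Δ y.
Proof.
have pp_lin := tens_map_linear pr_lin pr_lin.
have ppp_lin := tens_map_linear pr_lin pp_lin.
have in_bil z : bilinear (fun u v : A => u ⊗ (v ⊗ z)).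
  by split=> [v c u u'|u c v v']; rewrite ?tensorPl ?tensorPr.
have := congr1 (tens_map pr (tens_map pr pr)) (qsb_coassoc (unitz_in a)).
rewrite !(lin_sw _ _ ppp_lin) => /= H.
transitivity (\sw_(x, y <- qsb_cop A (unitz_in a))
    \sw_(x1, x2 <- qsb_cop A x) pr x1 ⊗ (pr x2 ⊗ pr y)).
  rewrite -[a in LHS]/(pr (unitz_in a)) -pr_cop sw_tens_map //.
    apply: sw_ext => x y; rewrite -pr_cop sw_tens_map //.
  split=> [y c x x'|x c y y']; first by rewrite sw_rcopP.
  by rewrite -sw_comb; apply: sw_ext => u v; rewrite !tensorPr.
transitivity (\sw_(x, y <- qsb_cop A (unitz_in a)) pr x ⊗ Δ (pr y)).
  rewrite -[RHS](_ : \sw_(x, y <- qsb_cop A (unitz_in a))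
    tens_map pr (tens_map pr pr) (x ⊗ qsb_cop A y) = _).
    rewrite -H; apply: sw_ext => x y; rewrite (lin_sw _ _ ppp_lin).
    by apply: sw_ext => u v; rewrite !tens_map_tensor.
  by apply: sw_ext => x y; rewrite tens_map_tensor // pr_cop.
rewrite -[a in RHS]/(pr (unitz_in a)) -pr_cop sw_tens_map //.
by split=> [y c x x'|x c y y']; rewrite ?rcop_lin ?tensorPl ?tensorPr.
Qed.

(** The form used in computations: a trilinear [f] induces the linear map [sweedler F] on triple
    tensors, which is applied to [rcop_coassoc_tens]. *)
Lemma rcop_coassoc M (f : A -> A -> A -> M) a :
  (forall y z, linear (fun x => f x y z)) ->
  (forall x z, linear (fun y => f x y z)) ->
  (forall x y, linear (fun z => f x y z)) ->
  \sw_(x, y <- Δ a) \sw_(x1, x2 <- Δ x) f x1 x2 y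
  = \sw_(x, y <- Δ a) \sw_(y1, y2 <- Δ y) f x y1 y2.
Proof.
move=> f1 f2 f3; pose F x := sweedler (f x).
have f_bil x : bilinear (f x) by [].
have F_bil : bilinear F.
  split=> [t c x x'|x]; last exact: sweedler_linear.
  by rewrite /F -sw_comb; apply: sw_ext => u v; apply: f1.
have F_lin := sweedler_linear F_bil.
have := congr1 (sweedler F) (rcop_coassoc_tens a).
rewrite !(lin_sw _ _ F_lin) => H.
transitivity (\sw_(x, y <- Δ a) \sw_(x1, x2 <- Δ x) sweedler F (x1 ⊗ (x2 ⊗ y))).
  apply: sw_ext => x y; apply: sw_ext => u v.
  by rewrite sweedler_tensor // /F sweedler_tensor.
transitivity (\sw_(x, y <- Δ a) sweedler F (x ⊗ Δ y)).
  by rewrite -H; apply: sw_ext => x y; rewrite lin_sw.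
by apply: sw_ext => x y; rewrite sweedler_tensor.
Qed.

End ReducedCoproduct.

(** * Equations solved along the reduced coproduct *)

Section Recursion.
Variables (k : fieldType) (A : qsBialgebra k).
Hypothesis A_conn : qs_connected A.
Local Notation Δ := (qsb_rcop A).
Implicit Types (a : A) (M : lmodType k).

Lemma iter_rcop_lin n : linear (@iter_rcop k A n).
Proof.
elim: n => [|n IHn] //= c a b; rewrite rcop_lin; exact: tens_map_linear.
Qed.

Lemma tens_map_iter_rcop n M (h : A -> tens_pow A n -> M) a : bilinear h ->
  sweedler h (iter_rcop n.+1 a) = \sw_(x, y <- Δ a) h x (iter_rcop n y).
Proof. by move=> h_bil; rewrite /= sw_tens_map //; apply: iter_rcop_lin. Qed.

(** The next iterate arises by applying [Δ] to the last tensor factor. This is the linear map [e],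
    so vanishing persists. *)
Lemma iter_rcopS_eq0 n a : iter_rcop n a = 0 -> iter_rcop n.+1 a = 0.
Proof.
suff [e e_lin ->] : exists2 e : tens_pow A n -> tens_pow A n.+1, linear e
    & forall a, iter_rcop n.+1 a = e (iter_rcop n a).
  by move=> ->; apply: lin0.
elim: n {a} => [|n [e e_lin eE]].
  exists Δ => [|a]; first exact: rcop_lin.
  by rewrite /= /tens_map sw_tensorK.
exists (tens_map id e) => [|a]; first exact: tens_map_linear.
rewrite [RHS]tens_map_iter_rcop; last exact: tens_map_bilinear.
by apply: sw_ext => x y; rewrite -eE.
Qed.

Lemma iter_rcop_eventually0 a :
  exists N, forall n, (N <= n)%N -> iter_rcop n a = 0.
Proof.
have [N [_ aN]] := A_conn a; exists N => n /subnK <-.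
by elim: (n - N)%N => [|m IHm] //; apply: iter_rcopS_eq0.
Qed.

Lemma sw_sum (U V M : lmodType k) I (r : seq I) (F : I -> U -> V -> M) t :
  \sw_(u, v <- t) (\sum_(i <- r) F i u v) = \sum_(i <- r) sweedler (F i) t.
Proof.
elim: r => [|i r IHr].
  by rewrite big_nil -[RHS](sw0 _ t); apply: sw_ext => u v; rewrite big_nil.
rewrite big_cons -IHr -swD; apply: sw_ext => u v; exact: big_cons.
Qed.

Section Right.
Variables (M : lmodType k) (f : A -> M) (Psi : A -> M -> M).
Hypotheses (f_lin : linear f) (Psi_bil : bilinear Psi).

(** The terms Psi a1 (Psi a2 (... (f a_{n+1}))) of the series that solves g a = f a + Psi a' (g a'')
    by repeated substitution. *)
Fixpoint right_term n a : M :=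
  if n is m.+1 then \sw_(x, y <- Δ a) Psi x (right_term m y) else f a.

(** The [n]-th term sees [a] only through its iterated coproduct, so connectedness makes the series
    finite at each [a]. *)
Lemma right_term_factor n : exists2 r : tens_pow A n -> M, linear r
  & forall a, right_term n a = r (iter_rcop n a).
Proof.
elim: n => [|n [r r_lin rE]]; first by exists f.
have h_bil : bilinear (fun x t => Psi x (r t)).
  by split=> [t c x x'|x c t t']; rewrite ?r_lin ?Psi_bil.1 ?Psi_bil.2.
exists (sweedler (fun x t => Psi x (r t))) => [|a]; first exact: sweedler_linear.
by rewrite tens_map_iter_rcop //; apply: sw_ext => x y; rewrite -rE.
Qed.

Lemma right_term_lin n : linear (right_term n).
Proof.
have [r r_lin rE] := right_term_factor n => c a b.
by rewrite !rE iter_rcop_lin r_lin.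
Qed.

Lemma right_term_eventually0 a :
  exists N, forall n, (N <= n)%N -> right_term n a = 0.
Proof.
have [N aN] := iter_rcop_eventually0 a; exists N => n Nn.
by have [r r_lin ->] := right_term_factor n; rewrite aN // lin0.
Qed.

Lemma right_rec_exists : exists2 g : A -> M, linear g
  & forall a, g a = f a + \sw_(x, y <- Δ a) Psi x (g y).
Proof.
have [N NP] := choice right_term_eventually0.
pose g a := \sum_(0 <= i < N a) right_term i a.
(* The cut-off [N a] varies with [a]; any larger bound gives the same sum, so different arguments
   can share one bound. *)
have gE a n : (N a <= n)%N -> g a = \sum_(0 <= i < n) right_term i a.
  move=> an; rewrite (big_cat_nat (leq0n _) an) /= [X in _ = _ + X]big_nat.
  rewrite [X in _ = _ + X]big1 ?addr0 //.
  by move=> i /andP[ai _]; apply: NP.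
exists g => [c a b|a].
  pose n := maxn (N (c *: a + b)) (maxn (N a) (N b)).
  rewrite !(@gE _ n) /n ?leq_max ?leqnn ?orbT // scaler_sumr -big_split.
  by apply: eq_bigr => i _; apply: right_term_lin.
(* One bound [n] serves all right factors occurring in [Δ a]. *)
have [n nP] := @sw_eventually _ _ _ (fun n (_ y : A) =>
  g y = \sum_(0 <= i < n) right_term i y) (Δ a) (fun _ y => ex_intro _ _ (gE y)).
(* The extra term is the zeroth one, [f a]; removing it leaves the tail indexed below the common
   bound. *)
rewrite (@gE a (maxn n (N a)).+1); last by rewrite leqW // leq_maxr.
rewrite big_nat_recl //=; congr (_ + _); rewrite -sw_sum; symmetry.
apply: (nP _ (leq_maxl n (N a))) => x y ->.
exact: (lin_sum (Psi_bil.2 x)).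
Qed.

End Right.

(** Substituting the equation into itself [n] times gives [g a = right_term g Psi n a], which is 0
    for large [n]. *)
Lemma right_rec_unique M (Psi : A -> M -> M) (g : A -> M) :
  bilinear Psi -> linear g ->
  (forall a, g a = \sw_(x, y <- Δ a) Psi x (g y)) -> forall a, g a = 0.
Proof.
move=> Psi_bil g_lin gE a.
have [n nP] := right_term_eventually0 g_lin Psi_bil a.
rewrite -(nP n (leqnn n)); elim: n {nP} a => [|n IHn] a //=.
by rewrite gE; apply: sw_ext => x y; rewrite IHn.
Qed.

Section Left.
Variables (M : lmodType k) (Psi : M -> A -> M).
Hypothesis Psi_bil : bilinear Psi.

(** The left-nested expression Psi (... (Psi (Psi m a1) a2) ...) a_{n+1}; the argument [m]
    accumulates the inner part, so that [Δ] is always applied on the right. *)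
Fixpoint left_term n (m : M) a : M :=
  if n is n'.+1 then \sw_(x, y <- Δ a) left_term n' (Psi m x) y else Psi m a.

Lemma left_term_factor n : exists2 l : M -> tens_pow A n -> M, bilinear l
  & forall m a, left_term n m a = l m (iter_rcop n a).
Proof.
elim: n => [|n [l l_bil lE]]; first by exists Psi.
have h_bil m : bilinear (fun x t => l (Psi m x) t).
  by split=> [t c x x'|x c t t']; rewrite ?Psi_bil.2 ?l_bil.1 ?l_bil.2.
exists (fun m => sweedler (fun x t => l (Psi m x) t)) => [|m a].
  split=> [t c m m'|m]; last exact: sweedler_linear.
  by rewrite -sw_comb; apply: sw_ext => x s; rewrite Psi_bil.1 l_bil.1.
by rewrite tens_map_iter_rcop //; apply: sw_ext => x y; rewrite -lE.
Qed.

Lemma left_term_bilinear n : bilinear (left_term n).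
Proof.
have [l l_bil lE] := left_term_factor n.
by split=> [a c m m'|m c a a']; rewrite !lE ?iter_rcop_lin ?l_bil.1 ?l_bil.2.
Qed.

(** Substituting the equation into [g a'] splits the left factor. Coassociativity moves the
    splitting to the right factor, where [iter_rcop] builds up and finally vanishes, uniformly over
    [Δ a]. *)
Lemma left_rec_unique (g : A -> M) : linear g ->
  (forall a, g a = \sw_(x, y <- Δ a) Psi (g x) y) -> forall a, g a = 0.
Proof.
move=> g_lin gE a.
have gE_term n : g a = \sw_(x, y <- Δ a) left_term n (g x) y.
  elim: n => [|n IHn]; first exact: gE.
  have [l1 l2] := left_term_bilinear n.
  rewrite IHn -(@rcop_coassoc _ _ _ (fun x y z => left_term n (Psi (g x) y) z)).
  - apply: sw_ext => x y; rewrite [in LHS]gE.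
    exact: (lin_sw (L := fun m => left_term n m y)).
  - by move=> y z c x x'; rewrite g_lin Psi_bil.1 l1.
  - by move=> x z c y y'; rewrite Psi_bil.2 l1.
  - by move=> x y; apply: l2.
have [n nP] := @sw_eventually _ _ _ (fun n (_ y : A) => iter_rcop n y = 0) (Δ a)
  (fun _ => iter_rcop_eventually0).
rewrite (gE_term n) -[RHS](sw0 _ (Δ a)); apply: (nP n) => // x y y0.
by have [l l_bil ->] := left_term_factor n; rewrite y0 (lin0 (l_bil.2 _)).
Qed.

End Left.

End Recursion.

(** * The antipode and the projection onto primitive elements *)

Section Projection.
Variables (k : fieldType) (A : qsBialgebra k).
Hypothesis A_conn : qs_connected A.
Local Notation Δ := (qsb_rcop A).
Implicit Types x y z a : A.

(* Up to sign, [S] is the antipode: the two equations say that it is a right and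
   a left inverse of the identity for the convolution product. *)
Lemma antipode_exists : exists S : A -> A,
  [/\ linear S, forall a, S a = a - \sw_(x, y <- Δ a) (x ⋆ S y)
    & forall a, S a = a - \sw_(x, y <- Δ a) (S x ⋆ y)].
Proof.
have negstar_bil : bilinear (fun x y : A => - (x ⋆ y)).
  by split=> [y c x x'|x c y y']; rewrite /= ?starPl ?starPr opprD scalerN.
have id_lin : linear (id : A -> A) by [].
have [S S_lin SE] := right_rec_exists A_conn id_lin negstar_bil.
have {}SE a : S a = a - \sw_(x, y <- Δ a) (x ⋆ S y) by rewrite -swN -SE.
exists S; split=> // a; apply/eqP; rewrite -subr_eq0; apply/eqP.
have starS_bil : bilinear (fun x y : A => S x ⋆ y).
  by split=> [y c x x'|x c y y']; rewrite ?S_lin ?starPl ?starPr.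
(* The goal is S = T. The difference solves the homogeneous equation g a = - a' ⋆ g a'', hence is
   0. *)
pose T a := a - \sw_(x, y <- Δ a) (S x ⋆ y).
have T_lin : linear T by apply: lin_fB => //; apply: sw_rcopP.
move: a; apply: (right_rec_unique A_conn negstar_bil (lin_fB S_lin T_lin)).
move=> a; rewrite swN.
transitivity (\sw_(x, y <- Δ a) (S x ⋆ y) - \sw_(x, y <- Δ a) (x ⋆ S y)).
  by rewrite SE /T opprB addrC addrA subrK.
(* Both S a' ⋆ a'' and a' ⋆ T a'' expand to a' ⋆ a'' - a' ⋆ S a'' ⋆ a''', by [SE] and by the
   definition of [T]. *)
transitivity (\sw_(x, y <- Δ a) (x ⋆ T y) - \sw_(x, y <- Δ a) (x ⋆ S y)).
  congr (_ - _).
  have starB x y z : (x ⋆ (y - z)) = (x ⋆ y) - (x ⋆ z).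
    by rewrite (linD ((star_bilinear A).2 x)) (linN ((star_bilinear A).2 x)).
  have starBl x y z : ((y - z) ⋆ x) = (y ⋆ x) - (z ⋆ x).
    by rewrite !(starC _ x) starB.
  transitivity (\sw_(x, y <- Δ a) (x ⋆ y)
      - \sw_(x, y <- Δ a) \sw_(x1, x2 <- Δ x) ((x1 ⋆ S x2) ⋆ y)).
    rewrite -swB; apply: sw_ext => x y; rewrite SE starBl.
    by rewrite (lin_sw _ _ ((star_bilinear A).1 y)).
  rewrite (rcop_coassoc (f := fun x y z => (x ⋆ S y) ⋆ z)).
  - rewrite -swB; apply: sw_ext => x y; rewrite starB.
    rewrite (lin_sw _ _ ((star_bilinear A).2 x)); congr (_ - _).
    by apply: sw_ext => u v; rewrite starA.
  - by move=> y z c x x'; rewrite !starPl.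
  - by move=> x z c y y'; rewrite S_lin starPr starPl.
  - by move=> x y c z z'; rewrite starPr.
rewrite -swB -swN; apply: sw_ext => x y.
rewrite -(linN ((star_bilinear A).2 x)) -(linN ((star_bilinear A).2 x)).
by rewrite -(linD ((star_bilinear A).2 x)) opprB.
Qed.

(** Take p a = a - a' ≺ S a''. The axiom [qs_precA] turns the left equation of [S] into the
    recursion for [p], and this recursion shows that [Δ (p a)] solves a homogeneous left
    equation. *)
Lemma prim_projection_exists : exists p : A -> A,
  [/\ linear p, forall a, Δ (p a) = 0
    & forall a, p a = a - \sw_(x, y <- Δ a) (p x ≺ y)].
Proof.
have [S [S_lin SE S'E]] := antipode_exists.
have precS_bil : bilinear (fun x y : A => x ≺ S y).
  by split=> [y c x x'|x c y y']; rewrite ?S_lin ?precPl ?precPr.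
pose p a := a - \sw_(x, y <- Δ a) (x ≺ S y).
have p_lin : linear p by apply: lin_fB => //; apply: sw_rcopP.
have pE a : p a = a - \sw_(x, y <- Δ a) (p x ≺ y).
  rewrite {1}/p; congr (_ - _); symmetry.
  transitivity (\sw_(x, y <- Δ a) (x ≺ y)
      - \sw_(x, y <- Δ a) \sw_(x1, x2 <- Δ x) ((x1 ≺ S x2) ≺ y)).
    rewrite -swB; apply: sw_ext => x y; rewrite /p.
    rewrite precDl (linN ((prec_bilinear A).1 y)).
    by rewrite (lin_sw _ _ ((prec_bilinear A).1 y)).
  rewrite (rcop_coassoc (f := fun x y z => (x ≺ S y) ≺ z)).
  - rewrite -swB; apply: sw_ext => x y; rewrite [in RHS]S'E.
    rewrite (linD ((prec_bilinear A).2 x)) (linN ((prec_bilinear A).2 x)).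
    rewrite (lin_sw _ _ ((prec_bilinear A).2 x)); congr (_ - _).
    by apply: sw_ext => u v; rewrite qs_precA.
  - by move=> y z c x x'; rewrite !precPl.
  - by move=> x z c y y'; rewrite S_lin precPr precPl.
  - by move=> x y c z z'; rewrite precPr.
exists p; split=> //.
(* [P y u v] collects the terms of [qsb_rcop_prec] for [Δ (p x ≺ y)] that involve [Δ (p x)], written
   there as [u ⊗ v]. *)
pose P y u v := \sw_(y1, y2 <- Δ y) ((u ≺ y1) ⊗ (v ⋆ y2)) + u ⊗ (v ⋆ y)
  + (u ≺ y) ⊗ v.
have in_bil u v : bilinear (fun y1 y2 : A => (u ≺ y1) ⊗ (v ⋆ y2)).
  by split=> [y c x x'|x c y y']; rewrite ?precPr ?starPr ?tensorPl ?tensorPr.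
have P_bil y : bilinear (P y).
  split=> [v|u].
    apply: lin_fD; last by move=> c u u'; rewrite precPl tensorPl.
    apply: lin_fD; last by move=> c u u'; rewrite tensorPl.
    move=> c u u'; rewrite -sw_comb; apply: sw_ext => y1 y2.
    by rewrite precPl tensorPl.
  apply: lin_fD; last by move=> c v v'; rewrite tensorPr.
  apply: lin_fD; last by move=> c v v'; rewrite starPl tensorPr.
  move=> c v v'; rewrite -sw_comb; apply: sw_ext => y1 y2.
  by rewrite starPl tensorPr.
have P_lin u v : linear (fun y => P y u v).
  apply: lin_fD; last by move=> c y y'; rewrite precPr tensorPl.
  apply: lin_fD; last by move=> c y y'; rewrite starPr tensorPr.
  exact: sw_rcopP.
have Psi_bil : bilinear (fun t y => - sweedler (P y) t).
  split=> [y|t c y y'].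
    by apply: lin_fN; apply: sweedler_linear.
  rewrite /= scalerN -opprD -sw_comb; congr (- _).
  by apply: sw_ext => u v; rewrite P_lin.
have dp_lin : linear (fun a => Δ (p a)).
  by move=> c a b; rewrite p_lin rcop_lin.
apply: (left_rec_unique A_conn Psi_bil dp_lin) => a.
have Δ_lin := @rcop_lin _ A.
rewrite swN pE (linD Δ_lin) (linN Δ_lin) (lin_sw _ _ Δ_lin).
have rcop_prec x y : Δ (p x ≺ y) = sweedler (P y) (Δ (p x))
    + (\sw_(y1, y2 <- Δ y) ((p x ≺ y1) ⊗ y2) + p x ⊗ y).
  by rewrite qsb_rcop_prec !swD -!addrA; congr (_ + (_ + _)); rewrite addrCA.
rewrite (sw_ext _ rcop_prec) swD opprD addrCA -[RHS]addr0; congr (_ + _).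
apply/eqP; rewrite subr_eq0; apply/eqP.
(* The other terms sum to [Δ a]: after coassociativity their left factor is p a' plus the sum of the
   p x ≺ y over [Δ a'], which is a' by [pE]. *)
rewrite swD -(rcop_coassoc (f := fun x y z => (p x ≺ y) ⊗ z)).
- rewrite -swD -[LHS]sw_tensorK; apply: sw_ext => x y.
  rewrite -(lin_sw _ _ ((tensor_bilinear A A).1 y)).
  rewrite -(linD ((tensor_bilinear A A).1 y)).
  by rewrite [in RHS]pE addrCA subrr addr0.
- by move=> y z c x x'; rewrite p_lin precPl tensorPl.
- by move=> x z c y y'; rewrite precPr tensorPl.
- by move=> x y c z z'; rewrite tensorPr.
Qed.

End Projection.

(** * The isomorphism with the algebra of words *)

Section BiliftBilinear.
Variables (k : fieldType) (V : lmodType k) (p : seq V -> seq V -> seq (seq V)).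
Hypotheses
  (p_mlinl : forall w, multilinear (fun v => \sum_(u <- p v w) word u))
  (p_mlinr : forall v, multilinear (fun w => \sum_(u <- p v w) word u)).

Lemma bilift_bilinear : bilinear (bilift p).
Proof.
split=> [y|x c y y'].
  apply: word_lift_linear => s1 s2 c a b.
  by rewrite -word_lift_comb; apply: word_lift_ext => d s; apply: p_mlinl.
rewrite /bilift -word_lift_comb; apply: word_lift_ext => a s.
exact: word_lift_linear.
Qed.

End BiliftBilinear.

(** * Deconcatenation of words *)

Section TplusCoproduct.
Variables (k : fieldType) (V : lmodType k).

Let word1_lin : linear (fun a : V => word [:: a]).
Proof. by move=> c a b; apply: (word_multilinear [::] [::]). Qed.

Definition deconcat (s : seq V) : tens (Tplus V) (Tplus V) :=
  \sum_(1 <= i < size s) word (take i s) ⊗ word (drop i s).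

(** Either the cut is right after the first letter, or that letter is put in front of the left piece
    of a later cut. [rcop_prim_prec] is the same recursion in [A]. *)
Lemma deconcat_cons a b s : deconcat (a :: b :: s)
  = word [:: a] ⊗ word (b :: s) + tens_map (wcons a) id (deconcat (b :: s)).
Proof.
have tm_lin : linear (tens_map (wcons a) (id : Tplus V -> Tplus V)).
  by apply: tens_map_linear => //; apply: (wcons_bilinear V).2.
rewrite /deconcat big_ltn // big_add1 /= ?take0; congr (_ + _).
(* Cuts start at 1, so the left piece is nonempty and [wcons_word] applies; [word [::]] is 0 and
   would lose the letter. *)
rewrite (lin_sum tm_lin) !big_nat; apply: eq_bigr => -[|i] // _.
by rewrite tens_map_tensor //= ?wcons_word //; apply: (wcons_bilinear V).2.
Qed.

Lemma deconcat_mlin : multilinear deconcat.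
Proof.
have [wcons1 wcons2] := wcons_bilinear V.
elim=> [|d s1 IHs] s2 c a b.
  case: s2 => [|b' s2]; first by rewrite /deconcat !big_geq // scaler0 addr0.
  rewrite !deconcat_cons word1_lin tensorPl scalerDr addrACA; congr (_ + _).
  rewrite -sw_comb; apply: sw_ext => u v.
  by rewrite wcons1 tensorPl.
have consE e : deconcat ((d :: s1) ++ e :: s2)
  = word [:: d] ⊗ word (s1 ++ e :: s2)
    + tens_map (wcons d) id (deconcat (s1 ++ e :: s2)).
  by case: (s1) => [|b' s1'] /=; rewrite deconcat_cons.
rewrite !consE IHs word_multilinear tensorPr tens_map_linear //.
by rewrite scalerDr addrACA.
Qed.

Lemma tplus_rcop_linear : linear (@tplus_rcop k V).
Proof. exact: word_lift_linear deconcat_mlin. Qed.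

End TplusCoproduct.

(** * The map [theta] and its compatibility with coproducts *)

Section ThetaTheory.
Variables (k : fieldType) (A : qsBialgebra k).
Local Notation Δ := (qsb_rcop A).
Local Notation P := (Prim A).
Implicit Types (a b : P) (s u v w : seq P) (x y : Tplus P).

Let val_lin : linear (val : P -> A). Proof. by []. Qed.

Lemma prim_rcop a : Δ (val a) = 0.
Proof. exact/eqP/(valP a). Qed.

(** Every term of [qsb_rcop_bul] runs over the reduced coproduct of [x] or of [y]. *)
Lemma prim_stableP : prim_stable A.
Proof.
move=> x y /eqP dx /eqP dy; rewrite unfold_in qsb_rcop_bul dx dy.
rewrite !sw_of0 ?addr0 ?eqxx //.
- by split=> [u c z z'|z c u u'] /=; rewrite ?bulPr ?tensorPl ?tensorPr.
- by split=> [u c z z'|z c u u'] /=; rewrite ?bulPl ?tensorPl ?tensorPr.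
have in_bil (x1 x2 : A) : bilinear (fun y1 y2 : A => (x1 • y1) ⊗ (x2 ⋆ y2)).
  by split=> [u c z z'|z c u u']; rewrite ?bulPr ?starPr ?tensorPl ?tensorPr.
by split=> [u c z z'|z c u u'] /=; rewrite !sw_of0 // scaler0 addr0.
Qed.

(** Of the five terms of [qsb_rcop_prec], the three running over [Δ (val a)] vanish. *)
Lemma rcop_prim_prec a (z : A) :
  Δ (val a ≺ z) = \sw_(z1, z2 <- Δ z) ((val a ≺ z1) ⊗ z2) + val a ⊗ z.
Proof.
have in_bil (x1 x2 : A) : bilinear (fun y1 y2 : A => (x1 ≺ y1) ⊗ (x2 ⋆ y2)).
  by split=> [y c x x'|x c y y']; rewrite ?precPr ?starPr ?tensorPl ?tensorPr.
rewrite qsb_rcop_prec prim_rcop !sw_of0 ?add0r ?addr0 //.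
- by split=> [y c x x'|x c y y'] /=; rewrite ?precPl ?tensorPl ?tensorPr.
- by split=> [y c x x'|x c y y'] /=; rewrite ?starPl ?tensorPl ?tensorPr.
split=> [y|x] c u u'; rewrite -sw_comb; apply: sw_ext => v v'.
  by rewrite precPl tensorPl.
by rewrite starPl tensorPr.
Qed.

Definition theta_word (s : seq P) : A :=
  if s is a :: s' then iter_prec (val a) (map val s') else 0.

Lemma theta_word_cons a b s :
  theta_word (a :: b :: s) = (val a ≺ theta_word (b :: s)).
Proof. by []. Qed.

Lemma theta_word_mlin : multilinear theta_word.
Proof.
elim=> [|d s1 IHs] s2 c a b.
  by case: s2 => [|b' s2]; rewrite /= ?val_lin // precPl.
have consE e : theta_word ((d :: s1) ++ e :: s2)
  = (val d ≺ theta_word (s1 ++ e :: s2)) by case: (s1).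
by rewrite !consE IHs precPr.
Qed.

Definition theta (x : Tplus P) : A := word_lift theta_word x.

Lemma theta_linear : linear theta.
Proof. exact: word_lift_linear theta_word_mlin. Qed.

Lemma thetaE a s : theta (word (a :: s)) = theta_word (a :: s).
Proof. exact: word_lift_word theta_word_mlin _ _. Qed.

Lemma theta_wcons a x : theta (wcons a x) = (val a ≺ theta x).
Proof.
have [wcons1 wcons2] := wcons_bilinear P.
move: x; apply: word_lin_ext => [c x y|c x y|b s].
- by rewrite wcons2 theta_linear.
- by rewrite theta_linear precPr.
by rewrite wcons_word !thetaE.
Qed.

(** Induction on the word: [theta_wcons] matches [deconcat_cons] with [rcop_prim_prec]. *)
Lemma theta_rcop x : Δ (theta x) = tens_map theta theta (tplus_rcop x).
Proof.
have [wcons1 wcons2] := wcons_bilinear P.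
move: x; apply: word_lin_ext => [c x y|c x y|a s].
- by rewrite theta_linear rcop_lin.
- by rewrite tplus_rcop_linear; apply: tens_map_linear; apply: theta_linear.
elim: s a => [|b s IHs] a.
  rewrite thetaE prim_rcop tplus_rcop_word big_geq //.
  by rewrite (lin0 (tens_map_linear theta_linear theta_linear)).
have tplusE c t : tplus_rcop (word (c :: t)) = deconcat (c :: t).
  exact: tplus_rcop_word.
rewrite -wcons_word theta_wcons rcop_prim_prec IHs wcons_word !tplusE deconcat_cons.
rewrite (linD (tens_map_linear theta_linear theta_linear)).
rewrite (tens_map_tensor theta_linear theta_linear) addrC !thetaE; congr (_ + _).
have theta2_bil := tens_map_bilinear theta_linear theta_linear.
have prec_bil : bilinear (fun z1 z2 : A => (val a ≺ z1) ⊗ z2).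
  by split=> [z c u u'|u c z z']; rewrite ?precPr ?tensorPl ?tensorPr.
rewrite (sw_tens_map _ _ _ prec_bil).
rewrite [RHS](sw_tens_map _ _ _ theta2_bil).
by apply: sw_ext => u v; rewrite theta_wcons.
Qed.

(** * Compatibility of [theta] with the products *)

Section Products.

Local Notation m := (prim_bul prim_stableP).

Let val_bul a b : val (m a b) = (val a • val b).
Proof. exact: SubK. Qed.

Lemma prim_bul_bilinear : bilinear m.
Proof.
split=> [y c x x'|x c y y']; apply: val_inj.
  by rewrite [RHS]val_lin !val_bul val_lin bulPl.
by rewrite [RHS]val_lin !val_bul val_lin bulPr.
Qed.

Let sum_star_cons (F : seq P -> A) a v b w :
  \sum_(u <- star_words m (a :: v) (b :: w)) F u
  = \sum_(u <- star_words m v (b :: w)) F (a :: u)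
    + (\sum_(u <- star_words m (a :: v) w) F (b :: u)
       + \sum_(u <- star_words m v w) F (m a b :: u)).
Proof. by rewrite /= !(big_cat, big_map). Qed.

(** Both words are nonempty, so each listed [u] has a first letter and [theta_word_cons] applies.
    For empty [u] it would fail, since [theta_word [::]] is 0. *)
Let sum_star_prec c a v b w :
  \sum_(u <- star_words m (a :: v) (b :: w)) theta_word (c :: u)
  = (val c ≺ \sum_(u <- star_words m (a :: v) (b :: w)) theta_word u).
Proof.
have prec_lin := (prec_bilinear A).2 (val c).
by rewrite !sum_star_cons !(linD prec_lin) !(lin_sum prec_lin).
Qed.

(** The claim is restricted to nonempty words because the empty word, the unit of ⋆, has no image in
    [A]: [theta_word] sends it to 0. *)
Let star_ok v w : Prop := if (v, w) is (_ :: _, _ :: _) then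
  \sum_(u <- star_words m v w) theta_word u = (theta_word v ⋆ theta_word w)
  else True.

(** This lemma and the next two match the three families of words in [star_words] with the three
    terms of [starE]. An empty tail gives a single word and is settled directly. *)
Let prec_of_star a v b w : star_ok v (b :: w) ->
  \sum_(u <- star_words m v (b :: w)) theta_word (a :: u)
  = (theta_word (a :: v) ≺ theta_word (b :: w)).
Proof.
case: v => [|a' v] vw; first by rewrite big_seq1.
by rewrite sum_star_prec vw theta_word_cons qs_precA.
Qed.

Let succ_of_star a v b w : star_ok (a :: v) w ->
  \sum_(u <- star_words m (a :: v) w) theta_word (b :: u)
  = (theta_word (b :: w) ≺ theta_word (a :: v)).
Proof.
case: w => [|b' w] vw; first by rewrite big_seq1.
by rewrite sum_star_prec vw [in RHS]theta_word_cons starC qs_precA.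
Qed.

Let bul_of_star a v b w : star_ok v w ->
  \sum_(u <- star_words m v w) theta_word (m a b :: u)
  = (theta_word (a :: v) • theta_word (b :: w)).
Proof.
case: v w => [|a' v] [|b' w] vw; rewrite ?big_seq1 ?theta_word_cons.
- exact: val_bul.
- by rewrite val_bul qs_bul_prec.
- by rewrite val_bul qs_bulC [RHS]qs_bulC qs_bul_prec.
by rewrite sum_star_prec vw val_bul bul_prec_prec.
Qed.

Let star_okP v w : star_ok v w.
Proof.
(* Induction on the total length, since the recursion shortens either word or both. *)
have [n] := ubnP (size v + size w); elim: n v w => // n IHn [|a v] [|b w] //=.
rewrite addSn addnS !ltnS => vw; rewrite /star_ok sum_star_cons.
rewrite prec_of_star ?succ_of_star ?bul_of_star ?addrA //; apply: IHn => /=;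
  by rewrite ?addSn ?addnS // ltnW.
Qed.

Lemma theta_prec x y : theta (tplus_prec m x y) = (theta x ≺ theta y).
Proof.
have m_bil := prim_bul_bilinear.
have [prec1 prec2] : bilinear (tplus_prec m).
  by apply: bilift_bilinear => s;
    [apply: prec_words_mlinl|apply: prec_words_mlinr] => //; apply: word_multilinear.
move: x; apply: word_lin_ext => [c x x'|c x x'|a v].
- by rewrite prec1 theta_linear.
- by rewrite theta_linear precPl.
move: y; apply: word_lin_ext => [c y y'|c y y'|b w].
- by rewrite prec2 theta_linear.
- by rewrite theta_linear precPr.
rewrite tplus_prec_word // (lin_sum theta_linear) !thetaE
  -(prec_of_star _ (star_okP _ _)).
by apply: eq_bigr => u _; rewrite thetaE.
Qed.

Lemma theta_bul x y : theta (tplus_bul m x y) = (theta x • theta y).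
Proof.
have m_bil := prim_bul_bilinear.
have [bul1 bul2] : bilinear (tplus_bul m).
  by apply: bilift_bilinear => s;
    [apply: bul_words_mlinl|apply: bul_words_mlinr] => //; apply: word_multilinear.
move: x; apply: word_lin_ext => [c x x'|c x x'|a v].
- by rewrite bul1 theta_linear.
- by rewrite theta_linear bulPl.
move: y; apply: word_lin_ext => [c y y'|c y y'|b w].
- by rewrite bul2 theta_linear.
- by rewrite theta_linear bulPr.
rewrite tplus_bul_word // (lin_sum theta_linear) !thetaE
  -(bul_of_star _ _ (star_okP _ _)).
by apply: eq_bigr => u _; rewrite thetaE.
Qed.

End Products.

Lemma theta_bijective : qs_connected A -> bijective theta.
Proof.
move=> A_conn; have [p [p_lin p_prim pE]] := prim_projection_exists A_conn.
have p_in z : p z \in @prim k A by apply/eqP/p_prim.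
pose pi z : P := Sub (p z) (p_in z).
have pi_lin : linear pi.
  by move=> c z z'; apply: val_inj; rewrite val_lin !SubK p_lin.
have [wcons1 wcons2] := wcons_bilinear P.
have word1_lin : linear (fun z => word [:: pi z]).
  by move=> c z z'; rewrite pi_lin; apply: (word_multilinear [::] [::]).
have wcons_pi_bil : bilinear (fun z t => wcons (pi z) t).
  by split=> [t c z z'|z c t t']; rewrite ?pi_lin ?wcons1 ?wcons2.
have [phi phi_lin phiE] := right_rec_exists A_conn word1_lin wcons_pi_bil.
have prec_p_bil : bilinear (fun z t : A => p z ≺ t).
  by split=> [t c z z'|z c t t']; rewrite ?p_lin ?precPl ?precPr.
exists phi => [x|z].
  move: x; apply: word_lin_ext => [c x y|//|a s].
    by rewrite theta_linear phi_lin.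
  have W_bil : bilinear (fun z t => wcons (pi z) (phi t)).
    by split=> [t c x x'|x c t t']; rewrite ?phi_lin ?pi_lin ?wcons1 ?wcons2.
  have pi_val b : pi (val b) = b.
    by apply: val_inj; rewrite SubK pE prim_rcop sw_of0 ?subr0.
  have p_prec b z : p (val b ≺ z) = 0.
    have Psi_bil : bilinear (fun m z : A => - (m ≺ z)).
      by split=> [t c x x'|x c t t'] /=; rewrite ?precPl ?precPr opprD scalerN.
    have p_prec_lin : linear (fun z => p (val b ≺ z)).
      by move=> c z' z''; rewrite precPr p_lin.
    (* As p b = b, the term b ≺ z cancels in [pE], leaving p (b ≺ z) = - p (b ≺ z') ≺ z''. *)
    move: z; apply: (left_rec_unique A_conn Psi_bil p_prec_lin) => z.
    rewrite pE rcop_prim_prec sw_ofD // sweedler_tensor // swN.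
    rewrite [p (val b)](congr1 val (pi_val b)) opprD addrCA subrr addr0.
rewrite (lin_sw _ _ (sweedler_linear prec_p_bil)).
    by congr (- _); apply: sw_ext => z1 z2; rewrite sweedler_tensor.
  have pi_prec b z : pi (val b ≺ z) = 0.
    by apply: val_inj; rewrite SubK p_prec.
  (* In [phiE] at b ≺ z only the term b ⊗ z of the coproduct contributes: the others have a left
     factor b ≺ z', killed by [pi]. *)
  have phi_prec b z : phi (val b ≺ z) = wcons b (phi z).
    rewrite phiE pi_prec (lin0 (word_multilinear [::] [::])) add0r.
    rewrite rcop_prim_prec sw_ofD // sweedler_tensor // pi_val.
    rewrite (lin_sw _ _ (sweedler_linear W_bil)).
    rewrite -[RHS]add0r; congr (_ + _); rewrite -[RHS](sw0 _ (Δ z)).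
    apply: sw_ext => z1 z2; rewrite sweedler_tensor // pi_prec.
    exact: lin0 (wcons1 _).
  elim: s a => [|b s IHs] a; last by rewrite -wcons_word theta_wcons phi_prec IHs.
  by rewrite thetaE phiE /= pi_val prim_rcop sw_of0 ?addr0.
(* Both theta (phi z) and z satisfy g z = p z + p z' ≺ g z'', so their difference solves the
   homogeneous equation. *)
apply/eqP; rewrite -subr_eq0; apply/eqP; move: z.
have h_lin : linear (fun z => theta (phi z) - z).
  apply: lin_fB => // c z z'; rewrite phi_lin; exact: theta_linear.
apply: (right_rec_unique A_conn prec_p_bil h_lin) => z.
rewrite phiE (linD theta_linear) thetaE /= (lin_sw _ _ theta_linear).
rewrite [p z]pE addrAC [_ - z]addrAC subrr add0r addrC -swB.
apply: sw_ext => z1 z2; rewrite theta_wcons.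
by rewrite (linD ((prec_bilinear A).2 _)) (linN ((prec_bilinear A).2 _)).
Qed.

HB.instance Definition _ :=
  GRing.isLinear.Build k (Tplus P) A _ theta theta_linear.

End ThetaTheory.

Theorem corollary28 (k : fieldType) (A : qsBialgebra k) (hA : qs_connected A) :
  exists st : prim_stable A,
  exists theta : {linear Tplus (Prim A) -> A},
    [/\ forall (a : Prim A) (s : seq (Prim A)),
          theta (word (a :: s)) = iter_prec (val a) (map val s),
        bijective theta,
        forall x y, theta (tplus_prec (prim_bul st) x y) = theta x ≺ theta y,
        forall x y, theta (tplus_bul (prim_bul st) x y) = theta x • theta y
      & forall x, qsb_rcop A (theta x) = tens_map theta theta (tplus_rcop x)].
Proof.
exists (@prim_stableP k A), (@theta k A); split.
- exact: thetaE.
- exact: theta_bijective.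
- exact: theta_prec.
- exact: theta_bul.
exact: theta_rcop.
Qed.
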